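(* Let $n\ge 2$ and let $\mathbf a=1\,2\cdots n$ and $\mathbf b=n\,(n-1)\cdots 1$ be vertices of $G(n)$. Then (a) $\mathbf a$ and $\mathbf b$ are the only vertices of $G(n)$ contained in a $1$-cycle; and (b) for every integer $k$ with $2\le k<n$, neither $\mathbf a$ nor $\mathbf b$ is contained in a $k$-cycle of $G(n)$.
   Context: For a sequence of distinct integers $c_1\cdots c_t$, $\mathrm{st}(c_1\cdots c_t)$ is the unique permutation $d_1\cdots d_t$ of $\{1,\dots,t\}$ with $d_i<d_j$ iff $c_i<c_j$. $G(n)$ is the directed multigraph whose vertices are the permutations of $\{1,\dots,n\}$ (one-line notation) and whose edges are the permutations $c_1\cdots c_{n+1}$ of $\{1,\dots,n+1\}$, the edge $c_1\cdots c_{n+1}$ going from $\mathrm{st}(c_1\cdots c_n)$ to $\mathrm{st}(c_2\cdots c_{n+1})$; so there is an edge from $x_1\cdots x_n$ to $w_1\cdots w_n$ iff $\mathrm{st}(x_2\cdots x_n)=\mathrm{st}(w_1\cdots w_{n-1})$. A closed $k$-walk $(v_1,\dots,v_k)$ is a sequence of vertices with an edge from $v_i$ to $v_{i+1}$ for $i<k$ and from $v_k$ to $v_1$; it is a $k$-cycle if $v_1,\dots,v_k$ are pairwise distinct (a $1$-cycle is a loop). *)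

(* Defs.v *)
From mathcomp Require Import all_boot all_order all_fingroup.

Set Implicit Arguments.
Unset Strict Implicit.
Unset Printing Implicit Defensive.

Import Order.TTheory.

(* The i-th letter of [st c] is the rank of c_i among the letters of c; see
   [st_perm], [st_lt] and [st_unique] for the defining property of st. *)
Definition st d (T : orderType d) (c : seq T) : seq nat :=
  [seq count (fun y => (y <= x)%O) c | x <- c].

Lemma size_st d (T : orderType d) (c : seq T) : size (st c) = size c.
Proof. exact: size_map. Qed.

Lemma st_lt d (T : orderType d) (x0 : T) (c : seq T) (i j : nat) :
  i < size c -> j < size c ->
  (nth 0 (st c) i < nth 0 (st c) j) = (nth x0 c i < nth x0 c j)%O.
Proof.
move=> ic jc; rewrite !(nth_map x0) //.
case: (leP (nth x0 c j) (nth x0 c i)) => [le_ji|lt_ij].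
  apply/negbTE; rewrite -leqNgt; apply: sub_count => y /= yj.
  exact: le_trans yj le_ji.
set x := nth x0 c i; set y := nth x0 c j.
have -> : count (fun z => (z <= y)%O) c =
    count (fun z => (z <= x)%O) c + count (fun z => (x < z <= y)%O) c.
  have le_xy : (x <= y)%O := ltW lt_ij.
  move: x y le_xy => x y le_xy; elim: (c) => //= z c' ->.
  rewrite addnACA; congr (_ + _); case: (leP z x) => //= zx.
  by rewrite (le_trans zx le_xy).
rewrite -[X in X < _]addn0 ltn_add2l -has_count; apply/hasP; exists y.
  exact: mem_nth.
by rewrite /= lt_ij lexx.
Qed.

Lemma st_perm d (T : orderType d) (c : seq T) :
  uniq c -> perm_eq (st c) (iota 1 (size c)).
Proof.
case: c => [//|x0 c']; set c := x0 :: c' => Uc.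
have Ust : uniq (st c).
  apply/(uniqP 0) => i j; rewrite !inE size_st => ic jc eq_ij.
  apply/(uniqP x0 Uc); rewrite ?inE //; apply/eqP; rewrite eq_le !leNgt.
  by rewrite -!st_lt // eq_ij ltnn.
have sub : {subset st c <= iota 1 (size c)}.
  move=> _ /mapP[x xc ->]; rewrite mem_iota add1n ltnS count_size andbT.
  by rewrite -has_count; apply/hasP; exists x => /=.
apply: uniq_perm; rewrite ?iota_uniq //.
by apply: (uniq_min_size Ust sub _).2; rewrite size_iota size_st.
Qed.

Lemma st_unique d (T : orderType d) (x0 : T) (c : seq T) (w : seq nat) :
  perm_eq w (iota 1 (size c)) ->
  (forall i j, i < size c -> j < size c ->
     (nth 0 w i < nth 0 w j) = (nth x0 c i < nth x0 c j)%O) ->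
  w = st c.
Proof.
move=> pw w_lt; have sw : size w = size c by rewrite (perm_size pw) size_iota.
apply: (@eq_from_nth _ 0) => [|i]; rewrite ?size_st // sw => ic.
rewrite (nth_map x0) //.
have le_wi : nth 0 w i <= size c.
  have : nth 0 w i \in w by rewrite mem_nth ?sw.
  by rewrite (perm_mem pw) mem_iota add1n ltnS => /andP[].
have -> : nth 0 w i = count (fun y => y <= nth 0 w i) w.
  rewrite (seq.permP pw) -[in RHS](subnKC le_wi) iotaD count_cat.
  rewrite (_ : count _ (iota 1 _) = size (iota 1 (nth 0 w i))); last first.
    by apply/eqP; rewrite -all_count; apply/allP => y; rewrite mem_iota; case/andP.
  rewrite (_ : count _ _ = 0) ?addn0 ?size_iota //; apply/eqP.
  rewrite -leqn0 leqNgt -has_count; apply/hasPn => y.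
  by rewrite mem_iota add1n -ltnNge => /andP[].
have count_nth (U : Type) (u0 : U) (P : pred U) (s : seq U) :
    count P s = count (fun j => P (nth u0 s j)) (iota 0 (size s)).
  by rewrite -[in LHS](mkseq_nth u0 s) count_map.
rewrite (count_nth _ 0) (count_nth _ x0) sw.
apply: eq_in_count => j; rewrite mem_iota /= add0n => jc.
by rewrite leqNgt (w_lt i j) // leNgt.
Qed.

(* One-line notation, with letters shifted from {0,...,n-1} to {1,...,n}. *)
Definition word n (s : 'S_n) : seq nat := [seq (s i : nat).+1 | i <- enum 'I_n].

Lemma word_perm n (s : 'S_n) : perm_eq (word s) (iota 1 n).
Proof.
apply: uniq_perm; rewrite ?iota_uniq //.
  by rewrite map_inj_uniq ?enum_uniq // => i j [] /val_inj /perm_inj.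
move=> k; rewrite mem_iota add1n ltnS; apply/mapP/idP => [[i _ ->]|]; first exact: ltn_ord.
case: k => [//|k] ltkn; exists ((s^-1)%g (Ordinal ltkn)); first by rewrite mem_enum.
by rewrite permKV.
Qed.

(* The vertices of G(n) are the elements of 'S_n, its edges those of 'S_n.+1. *)
Definition edge_from_to n (c : 'S_n.+1) (x w : 'S_n) : bool :=
  (word x == st (take n (word c))) && (word w == st (drop 1 (word c))).

Definition adj n : rel 'S_n := [rel x w | [exists c, edge_from_to c x w]].

Definition closed_walk n (k : nat) (v : k.-tuple 'S_n) : bool := path.cycle (@adj n) v.

Definition is_cycle n (k : nat) (v : k.-tuple 'S_n) : bool :=
  closed_walk v && uniq v.

Definition in_cycle n (k : nat) (x : 'S_n) : Prop :=
  exists2 v : k.-tuple 'S_n, is_cycle v & x \in v.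

Definition vertex_a {n} : 'S_n := 1%g.

Definition vertex_b {n} : 'S_n := perm (@rev_ord_inj n).

Lemma word_a n : word (@vertex_a n) = iota 1 n.
Proof.
rewrite /word; under eq_map do rewrite perm1.
by rewrite (map_comp S val) val_enum_ord -(iotaDl 1 0).
Qed.

Lemma word_b n : word (@vertex_b n) = rev (iota 1 n).
Proof.
apply: (@eq_from_nth _ 0) => [|i].
  by rewrite size_map size_enum_ord size_rev size_iota.
rewrite size_map size_enum_ord => ltin; have i0 := Ordinal ltin.
rewrite nth_rev ?size_iota // (nth_map i0) ?size_enum_ord // permE /=.
by rewrite nth_enum_ord // nth_iota ?add1n // subnSK // leq_subr.
Qed.

(* Main.v *)
Require Import Defs.
From mathcomp Require Import all_boot all_order all_fingroup.
From mathcomp Require Import zify.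

Set Implicit Arguments.
Unset Strict Implicit.
Unset Printing Implicit Defensive.

(** Along an edge the ascent/descent pattern of a vertex is shifted by one
    place to the left, and a and b are the vertices whose pattern is constant.
    A loop forces the pattern to be constant.  If a (or b) lies on a k-cycle
    with k < n, the shift gives its successor y the same constant pattern
    except perhaps at the last place; and the entry of y at that place is
    shifted, in the k - 1 steps from y back to a, to a place that still exists.
    Hence y = a, which is impossible when k > 1. *)

(** Only the places with [i.+1 < n] carry information; beyond them the default letter [0] makes the
    value false. *)
Definition asc {n} (x : 'S_n) (i : nat) : bool :=
  nth 0 (word x) i < nth 0 (word x) i.+1.

Lemma size_word n (x : 'S_n) : size (word x) = n.
Proof. by rewrite size_map size_enum_ord. Qed.

Lemma word_uniq n (x : 'S_n) : uniq (word x).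
Proof. by rewrite (perm_uniq (word_perm x)) iota_uniq. Qed.

Lemma word_inj n : injective (@word n).
Proof.
move=> x y /eq_in_map eq_xy; apply/permP => i.
by apply/val_inj/succn_inj/eq_xy; rewrite mem_enum.
Qed.

Lemma asc_a n i : i.+1 < n -> asc (@vertex_a n) i.
Proof. by move=> ltin; rewrite /asc word_a !nth_iota //; lia. Qed.

Lemma asc_b n i : i.+1 < n -> asc (@vertex_b n) i = false.
Proof.
by move=> ltin; rewrite /asc word_b !nth_rev ?size_iota ?nth_iota; lia.
Qed.

(** A strictly increasing word is determined by its set of letters, here [iota 1 n]. *)
Lemma asc_a_eq n (x : 'S_n) :
  (forall i, i.+1 < n -> asc x i) -> x = vertex_a.
Proof.
move=> xP; apply: word_inj; rewrite word_a.
apply: (irr_sorted_eq ltn_trans ltnn); last exact/perm_mem/word_perm.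
  by apply/(sortedP 0) => i; rewrite size_word => /xP.
exact: iota_ltn_sorted.
Qed.

Lemma asc_b_eq n (x : 'S_n) :
  (forall i, i.+1 < n -> asc x i = false) -> x = vertex_b.
Proof.
move=> xP; apply: word_inj; rewrite word_b.
have gtn_trans : transitive gtn by move=> p m q /= mp pq; apply: ltn_trans mp.
apply: (irr_sorted_eq gtn_trans ltnn).
- apply/(sortedP 0) => i; rewrite size_word => ltin.
  (* A non-ascent is only a weak descent; distinctness of the letters makes it strict. *)
  rewrite /= ltn_neqAle nth_uniq ?size_word ?word_uniq // ?(ltnW ltin) //.
  by rewrite leqNgt -/(asc x i) xP // andbT; lia.
- by rewrite rev_sorted iota_ltn_sorted.
- by move=> j; rewrite mem_rev; apply/perm_mem/word_perm.
Qed.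

(** Both sides compare the letters of the edge [c] at places [i.+1] and [i.+2], since [st] preserves
    order. *)
Lemma adj_asc n (x w : 'S_n) i :
  adj x w -> i.+2 < n -> asc w i = asc x i.+1.
Proof.
case/existsP=> c /andP[/eqP xE /eqP wE] ltin; rewrite /asc xE wE.
rewrite !(st_lt 0) ?size_drop ?size_takel ?size_word; try lia.
by rewrite !nth_drop !nth_take //; lia.
Qed.

Lemma path_asc n (x y : 'S_n) s i :
  path (@adj n) y (rcons s x) -> i + (size s).+1 < n.-1 ->
  asc x i = asc y (i + (size s).+1).
Proof.
elim: s y => [|z s IHs] y /= => [/andP[yx _]|/andP[yz zx]] lti.
  by rewrite addn1; apply: adj_asc yx _; lia.
rewrite (IHs z zx) ?addnS; last by lia.
by apply: adj_asc yz _; lia.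
Qed.

(** The start [m] is free because the two windows of the edge giving the loop begin at 1 and at
    2. *)
Lemma st_iota m n : st (iota m n) = iota 1 n.
Proof.
apply/esym/(@st_unique _ _ 0); rewrite size_iota // => i j lti ltj.
by rewrite !nth_iota // ltEnat /= !ltn_add2l.
Qed.

Lemma st_rev_iota m n : st (rev (iota m n)) = rev (iota 1 n).
Proof.
apply/esym/(@st_unique _ _ 0); rewrite size_rev size_iota ?perm_rev //.
move=> i j lti ltj.
by rewrite !nth_rev ?size_iota // !nth_iota ?ltEnat /=; lia.
Qed.

Lemma adj_aa n : adj (@vertex_a n) vertex_a.
Proof.
(* The witness is the increasing permutation of [n.+1] letters. *)
apply/existsP; exists vertex_a; rewrite /edge_from_to !word_a take_iota.
by rewrite (minn_idPl (leqnSn n)) /= drop0 !st_iota eqxx.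
Qed.

Lemma adj_bb n : adj (@vertex_b n) vertex_b.
Proof.
apply/existsP; exists vertex_b; rewrite /edge_from_to !word_b.
rewrite take_rev drop_rev size_iota subSnn subn1 take_iota.
by rewrite (minn_idPl (leqnSn n)) /= drop0 !st_rev_iota !eqxx.
Qed.

Lemma in_cycle1 n (x : 'S_n) : in_cycle 1 x <-> adj x x.
Proof.
split=> [[v]|xx]; last first.
  by exists [tuple x]; rewrite ?inE // /is_cycle /closed_walk /= xx.
case: (tupleP v) => y t; rewrite (tuple0 t) /is_cycle /closed_walk /=.
by rewrite !andbT inE => yy /eqP->.
Qed.

Lemma adj_loop n (x : 'S_n) : adj x x <-> x = vertex_a \/ x = vertex_b.
Proof.
split=> [xx|[]->]; [|exact: adj_aa|exact: adj_bb].
have asc0 i : i.+1 < n -> asc x i = asc x 0.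
  by elim: i => // i IHi lti; rewrite -(adj_asc xx lti) IHi // ltnW.
case x0: (asc x 0); [left; apply: asc_a_eq|right; apply: asc_b_eq] => i /asc0.
  by rewrite x0 => ->.
by rewrite x0.
Qed.

Lemma constant_asc_cycle n k (x : 'S_n) (e : bool) :
  2 <= k < n -> (forall i, i.+1 < n -> asc x i = e) -> in_cycle k x ->
  exists2 y : 'S_n, x != y & forall i, i.+1 < n -> asc y i = e.
Proof.
move=> /andP[k2 ltkn] xP [v /andP[walk Uv] xv].
(* Rotate the cycle to start at [x]; its successor will be [y], and [k] becomes [(size s).+2]. *)
case: (rot_to xv) => m s rot_v.
move: walk Uv (size_tuple v); rewrite /closed_walk -(rot_cycle m).
rewrite -(rot_uniq m) -(size_rot m).
rewrite {}rot_v; case: s => [|y s] /=; first by lia.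
rewrite inE negb_or -andbA => /andP[xy yx] /andP[x_y _] sk.
exists y => // i lti; have [lti2|] := ltnP i.+2 n.
  by rewrite (adj_asc xy) // xP.
(* Here [i] is the last place, n - 2, and the k - 1 edges from [y] back to [x] carry it to place n -
   1 - k, which is nonnegative as k < n. *)
move=> gei; have lesi : (size s).+1 <= i by rewrite -ltnS sk; lia.
by rewrite -(subnK lesi) -(path_asc yx) ?subnK ?xP //; lia.
Qed.

Theorem theorem3p6 (n : nat) (hn : 2 <= n) :
  (forall x : 'S_n, in_cycle 1 x <-> (x = vertex_a \/ x = vertex_b)) /\
  (forall k : nat, 2 <= k < n ->
     ~ in_cycle k (@vertex_a n) /\ ~ in_cycle k (@vertex_b n)).
Proof.
split=> [x|k hk]; first by rewrite in_cycle1 adj_loop.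
split=> [/(constant_asc_cycle (e := true) hk (@asc_a n))|
         /(constant_asc_cycle (e := false) hk (@asc_b n))] [y + yP].
  by rewrite (asc_a_eq yP) eqxx.
by rewrite (asc_b_eq yP) eqxx.
Qed.
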